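(* Let $\alpha,\beta,\gamma,\delta\in\mathbb{R}$ with $\alpha+\delta\neq 0$ and $\alpha\gamma-\beta\delta=0$, and let $(G_6,g,J)$ be the connected, simply connected three-dimensional Lorentzian Lie group with product structure $J$ whose Lie algebra $\mathfrak{g}$ has a pseudo-orthonormal basis $\{e_1,e_2,e_3\}$ ($e_3$ timelike) with $[e_1,e_2]=\alpha e_2+\beta e_3$, $[e_1,e_3]=\gamma e_2+\delta e_3$, $[e_2,e_3]=0$. Let $c\in\mathbb{R}$. Then $(G_6,g,J)$ is a first kind algebraic Ricci soliton associated to the Kobayashi-Nomizu connection $\nabla^1$ with constant $c$ if and only if one of the following holds: (i) $\alpha=\beta=c=0$, $\delta\neq 0$; in particular, $D=0$; (ii) $\alpha\neq 0$, $\beta=\gamma=0$, $\alpha^2+c=0$, $\alpha+\delta\neq 0$; in particular, $De_1=0$, $De_2=0$, $De_3=\alpha^2e_3$.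
   Context: The left-invariant Lorentzian metric $g$ satisfies $g(e_1,e_1)=g(e_2,e_2)=1$, $g(e_3,e_3)=-1$, $g(e_i,e_j)=0$ for $i\ne j$. All tensors and connections are left-invariant and evaluated on $\mathfrak{g}$. $\nabla$ is the Levi-Civita connection of $g$. The product structure is $Je_1=e_1$, $Je_2=e_2$, $Je_3=-e_3$, and $(\nabla_XJ)Y=\nabla_X(JY)-J(\nabla_XY)$. The canonical connection is $\nabla^0_XY=\nabla_XY-\frac12(\nabla_XJ)(JY)$ and the Kobayashi-Nomizu connection is $\nabla^1_XY=\nabla^0_XY-\frac14[(\nabla_YJ)(JX)-(\nabla_{JY}J)X]$, with curvature $R^1(X,Y)Z=\nabla^1_X\nabla^1_YZ-\nabla^1_Y\nabla^1_XZ-\nabla^1_{[X,Y]}Z$. Its Ricci tensor is $\rho^1(X,Y)=-g(R^1(X,e_1)Y,e_1)-g(R^1(X,e_2)Y,e_2)+g(R^1(X,e_3)Y,e_3)$ and the Ricci operator $\mathrm{Ric}^1$ is defined by $\rho^1(X,Y)=g(\mathrm{Ric}^1(X),Y)$. First kind algebraic Ricci soliton associated to $\nabla^1$ with constant $c$ means: $\mathrm{Ric}^1=c\,\mathrm{Id}+D$ where $D$ is a derivation of $\mathfrak{g}$, i.e. a linear map with $D[X,Y]=[DX,Y]+[X,DY]$ for all $X,Y\in\mathfrak{g}$. *)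

(* Defs.v *)
From HB Require Import structures.
From mathcomp Require Import all_boot all_order all_algebra.
From mathcomp Require Import reals.

Set Implicit Arguments.
Unset Strict Implicit.
Unset Printing Implicit Defensive.
Import Order.TTheory GRing.Theory Num.Theory.
Local Open Scope ring_scope.

(* Left-invariant tensors and connections on a Lie group are identified with
   (multi)linear maps on its Lie algebra V.  In particular a left-invariant
   affine connection is a bilinear map V -> V -> V, and derivatives of the
   (constant) functions g Y Z vanish in the metricity condition. *)
Section LeftInvariantGeometry.
Variables (R : realType) (V : vectType R).

Definition is_lie_bracket (br : {bilinear V -> V -> V}) : Prop :=
  (forall X, br X X = 0) /\
  (forall X Y Z, br X (br Y Z) + br Y (br Z X) + br Z (br X Y) = 0).

Definition is_pseudo_orthonormal_basis (g : {biscalar V}) (e1 e2 e3 : V) : Prop :=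
  [/\ basis_of {:V} [:: e1; e2; e3],
      [/\ g e1 e1 = 1, g e2 e2 = 1 & g e3 e3 = -1] &
      [/\ g e1 e2 = 0, g e1 e3 = 0 & g e2 e3 = 0]].

Definition is_symmetric_form (g : {biscalar V}) : Prop :=
  forall X Y, g X Y = g Y X.

Definition is_levi_civita (br : {bilinear V -> V -> V}) (g : {biscalar V})
    (nabla : {bilinear V -> V -> V}) : Prop :=
  (forall X Y, nabla X Y - nabla Y X = br X Y) /\
  (forall X Y Z, g (nabla X Y) Z + g Y (nabla X Z) = 0).

(* cov_endo nabla J X Y is (nabla_X J) Y. *)
Definition cov_endo (nabla : V -> V -> V) (J : 'End(V)) (X Y : V) : V :=
  nabla X (J Y) - J (nabla X Y).

Definition canonical_connection (nabla : V -> V -> V) (J : 'End(V))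
    (X Y : V) : V :=
  nabla X Y - (1 / 2) *: cov_endo nabla J X (J Y).

Definition kobayashi_nomizu_connection (nabla : V -> V -> V) (J : 'End(V))
    (X Y : V) : V :=
  canonical_connection nabla J X Y
  - (1 / 4) *: (cov_endo nabla J Y (J X) - cov_endo nabla J (J Y) X).

Definition curvature (br : V -> V -> V) (nabla : V -> V -> V) (X Y Z : V) : V :=
  nabla X (nabla Y Z) - nabla Y (nabla X Z) - nabla (br X Y) Z.

Definition ricci_tensor (br : V -> V -> V) (g : V -> V -> R) (e1 e2 e3 : V)
    (nabla : V -> V -> V) (X Y : V) : R :=
  - g (curvature br nabla X e1 Y) e1
  - g (curvature br nabla X e2 Y) e2
  + g (curvature br nabla X e3 Y) e3.

Definition is_ricci_operator (g : V -> V -> R) (rho : V -> V -> R)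
    (Ric : 'End(V)) : Prop :=
  forall X Y, rho X Y = g (Ric X) Y.

Definition is_lie_derivation (br : V -> V -> V) (D : 'End(V)) : Prop :=
  forall X Y, D (br X Y) = br (D X) Y + br X (D Y).

Definition first_kind_soliton_with (br : V -> V -> V) (Ric : 'End(V)) (c : R)
    (D : 'End(V)) : Prop :=
  Ric = c *: \1%VF + D /\ is_lie_derivation br D.

Definition first_kind_algebraic_ricci_soliton (br : V -> V -> V)
    (Ric : 'End(V)) (c : R) : Prop :=
  exists D : 'End(V), first_kind_soliton_with br Ric c D.

End LeftInvariantGeometry.

(* Main.v *)
(** The Koszul formula determines nabla, hence nabla^1, on the basis, and gives
    Ric^1 = diag(-(alpha^2 + beta gamma), -alpha^2, 0).  The derivation property
    of D = Ric^1 - c Id on [e1, e2] and [e1, e3] contains the equations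
    alpha K = delta K = 0 with K = alpha^2 + beta gamma + c, so K = 0 because
    alpha + delta <> 0.  What remains reduces to beta alpha^2 = gamma alpha^2 = 0,
    and the two cases are alpha = 0, where alpha gamma = beta delta forces
    beta = 0, and alpha <> 0. *)

Require Import Defs.
From HB Require Import structures.
From mathcomp Require Import all_boot all_order all_algebra.
From mathcomp Require Import reals.
From mathcomp Require Import ring lra.

Set Implicit Arguments.
Unset Strict Implicit.
Unset Printing Implicit Defensive.
Import Order.TTheory GRing.Theory Num.Theory.
Local Open Scope ring_scope.

(* [do !split] would also unify the two sides of each equation. *)
Ltac split_table := repeat match goal with |- prod _ _ => split end.

Lemma lie_bracketC (R : realType) (V : vectType R)
    (br : {bilinear V -> V -> V}) :
  is_lie_bracket br -> forall X Y, br X Y = - br Y X.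
Proof.
case=> br_alt _ X Y; apply/eqP; rewrite -addr_eq0.
move/eqP: (br_alt (X + Y)).
by rewrite linearDl !linearDr /= !br_alt add0r addr0.
Qed.

(* Keyed on one map, these rewrite much faster than the generic [linearD] etc. *)
Lemma endoE (R : realType) (V : vectType R) (f : 'End(V)) :
  ((f 0 = 0) * (forall X, f (- X) = - f X) *
   (forall X Y, f (X + Y)%R = (f X + f Y)%R) *
   (forall a X, f (a *: X) = a *: f X))%type.
Proof.
split_table=> *; [exact: linear0 | exact: linearN | exact: linearD
  | exact: linearZ_LR].
Qed.

Lemma bilinearE (R : realType) (V : vectType R) (W : zmodType)
    (s : R -> W -> W) (f : {bilinear V -> V -> W | s & s}) :
  ((forall Z, f 0 Z = 0) * (forall Z, f Z 0 = 0) *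
   (forall X Z, f (- X) Z = - f X Z) * (forall Z X, f Z (- X) = - f Z X) *
   (forall X Y Z, f (X + Y)%R Z = (f X Z + f Y Z)%R) *
   (forall Z X Y, f Z (X + Y)%R = (f Z X + f Z Y)%R) *
   (forall a X Z, f (a *: X) Z = s a (f X Z)) *
   (forall Z a X, f Z (a *: X) = s a (f Z X)))%type.
Proof.
split_table=> *; [exact: linear0l | exact: linear0r | exact: linearNl
  | exact: linearNr | exact: linearDl | exact: linearDr | exact: linearZl_LR
  | exact: linearZr_LR].
Qed.

Section PseudoOrthonormalBasis.
Variables (R : realType) (V : vectType R) (g : {biscalar V}) (e1 e2 e3 : V).
Hypothesis g_sym : is_symmetric_form g.
Hypothesis e_basis : is_pseudo_orthonormal_basis g e1 e2 e3.

Lemma gram :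
  ((g e1 e1 = 1) * (g e1 e2 = 0) * (g e1 e3 = 0) *
   (g e2 e1 = 0) * (g e2 e2 = 1) * (g e2 e3 = 0) *
   (g e3 e1 = 0) * (g e3 e2 = 0) * (g e3 e3 = -1))%type.
Proof.
by case: e_basis => _ [? ? ?] [? ? ?]; split_table=> //; rewrite g_sym.
Qed.

Lemma basis3_lincomb X : exists a b d, X = a *: e1 + b *: e2 + d *: e3.
Proof.
case: e_basis => /andP[/eqP span_e _] _ _.
have: X \in <<[:: e1; e2; e3]>>%VS by rewrite span_e memvf.
rewrite !span_cons span_nil addv0.
case/memv_addP=> _ /vlineP[a ->] [_ /memv_addP[_ /vlineP[b ->]]] [_ /vlineP[d ->] ->] ->.
by exists a, b, d; rewrite addrA.
Qed.

(** The Gram matrix is diagonal with entries 1, 1, -1, so pairing with the basis recovers the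
    coordinates up to sign. This is how every vector identity below becomes three scalar identities
    for [ring], [field] or [lra]. *)
Lemma eq_from_metric X Y :
  g X e1 = g Y e1 -> g X e2 = g Y e2 -> g X e3 = g Y e3 -> X = Y.
Proof.
move: (basis3_lincomb X) (basis3_lincomb Y) => [a [b [d ->]]] [a' [b' [d' ->]]].
rewrite !(linearDl, linearZl_LR) /= !gram => H1 H2 H3.
by congr (_ *: _ + _ *: _ + _ *: _); lra.
Qed.

Lemma basis3_ind (P : V -> Prop) :
  (forall a X Y, P X -> P Y -> P (a *: X + Y)) ->
  P e1 -> P e2 -> P e3 -> forall X, P X.
Proof.
move=> P_lin P1 P2 P3 X; have P0: P 0.
  (* [P 0] comes from writing 0 as (-1) e1 + e1; it ends the chain of linear combinations. *)
  by rewrite -(addNr e1) -scaleN1r; apply: (P_lin).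
case: (basis3_lincomb X) => a [b [d ->]].
rewrite -addrA; apply: (P_lin) => //; apply: (P_lin) => //.
by rewrite -[_ *: _]addr0; apply: P_lin.
Qed.

Lemma eq_endo_on_basis (f h : 'End(V)) :
  f e1 = h e1 -> f e2 = h e2 -> f e3 = h e3 -> f = h.
Proof.
move=> *; apply/lfunP; apply: basis3_ind => // a X Y eqX eqY.
by rewrite !linearP /= eqX eqY.
Qed.

(** The defect D[X,Y] - [DX,Y] - [X,DY] is bilinear and alternating, so it vanishes once it does on
    the pairs of basis vectors with i < j. *)
Lemma lie_derivation_on_basis (br : {bilinear V -> V -> V}) (D : 'End(V)) :
    is_lie_bracket br ->
    D (br e1 e2) = br (D e1) e2 + br e1 (D e2) ->
    D (br e1 e3) = br (D e1) e3 + br e1 (D e3) ->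
    D (br e2 e3) = br (D e2) e3 + br e2 (D e3) ->
  is_lie_derivation br D.
Proof.
move=> br_lie D12 D13 D23; have [br_alt _] := br_lie.
have brC := lie_bracketC br_lie.
have D_alt X : D (br X X) = br (D X) X + br X (D X).
  by rewrite br_alt linear0 [br X _]brC subrr.
have D_sym X Y : D (br X Y) = br (D X) Y + br X (D Y) ->
    D (br Y X) = br (D Y) X + br Y (D X).
  by move=> DXY; rewrite brC linearN /= DXY opprD -!brC addrC.
have D_linr a Y Y' X : D (br X Y) = br (D X) Y + br X (D Y) ->
    D (br X Y') = br (D X) Y' + br X (D Y') ->
    D (br X (a *: Y + Y')) = br (D X) (a *: Y + Y') + br X (D (a *: Y + Y')).
  move=> DY DY'; rewrite !(linearDr, linearZr_LR, linearD, linearZ_LR) /=.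
  by rewrite DY DY' scalerDr addrACA.
(* Linearity in the left argument is linearity in the right one, conjugated by the swap [D_sym]. *)
apply: basis3_ind => [a X X' DX DX' Y|||]; first by apply/D_sym/D_linr; apply/D_sym.
all: by apply: basis3_ind; auto.
Qed.

(** Koszul formula without derivative terms, since g is constant on left-invariant fields: replace
    brackets by the torsion identity and combine metricity over the cyclic permutations of X, Y,
    Z. *)
Lemma koszul (br nabla : {bilinear V -> V -> V}) X Y Z :
    is_levi_civita br g nabla ->
  g (nabla X Y) Z = (g (br X Y) Z - g (br Y Z) X + g (br Z X) Y) / 2.
Proof.
case=> torsion metric; rewrite -!torsion !linearBl /=.
have := (metric X Y Z, metric Y Z X, metric Z X Y).
rewrite (g_sym Y) (g_sym Z) (g_sym X) => -[[? ?] ?]; lra.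
Qed.

End PseudoOrthonormalBasis.

Section KobayashiNomizu.
Variables (R : realType) (V : vectType R) (alpha beta gamma delta : R).
Variables (br : {bilinear V -> V -> V}) (g : {biscalar V}) (e1 e2 e3 : V).
Variables (J : 'End(V)) (nabla : {bilinear V -> V -> V}).
Hypothesis br_lie : is_lie_bracket br.
Hypothesis g_sym : is_symmetric_form g.
Hypothesis e_basis : is_pseudo_orthonormal_basis g e1 e2 e3.
Hypothesis br12 : br e1 e2 = alpha *: e2 + beta *: e3.
Hypothesis br13 : br e1 e3 = gamma *: e2 + delta *: e3.
Hypothesis br23 : br e2 e3 = 0.
Hypothesis J_e : [/\ J e1 = e1, J e2 = e2 & J e3 = - e3].
Hypothesis nabla_LC : is_levi_civita br g nabla.

Let gramE := gram g_sym e_basis.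
Let linE := (endoE J, bilinearE br, bilinearE nabla, bilinearE g).

Lemma bracket_table :
  ((br e1 e1 = 0) * (br e1 e2 = (alpha *: e2 + beta *: e3)%R) *
   (br e1 e3 = (gamma *: e2 + delta *: e3)%R) *
   (br e2 e1 = - (alpha *: e2 + beta *: e3)%R) * (br e2 e2 = 0) *
   (br e2 e3 = 0) *
   (br e3 e1 = - (gamma *: e2 + delta *: e3)%R) * (br e3 e2 = 0) *
   (br e3 e3 = 0))%type.
Proof.
have [br_alt _] := br_lie; have brC := lie_bracketC br_lie.
rewrite !br_alt (brC e2 e1) (brC e3 e1) (brC e3 e2).
by rewrite br12 br13 br23 oppr0; split_table.
Qed.

Lemma levi_civita_table :
  ((nabla e1 e1 = 0) *
   (nabla e1 e2 = ((beta + gamma) / 2)%R *: e3) *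
   (nabla e1 e3 = ((beta + gamma) / 2)%R *: e2) *
   (nabla e2 e1 = (- alpha *: e2 + ((gamma - beta) / 2) *: e3)%R) *
   (nabla e2 e2 = alpha *: e1) *
   (nabla e2 e3 = ((gamma - beta) / 2)%R *: e1) *
   (nabla e3 e1 = (((beta - gamma) / 2) *: e2 - delta *: e3)%R) *
   (nabla e3 e2 = ((gamma - beta) / 2)%R *: e1) *
   (nabla e3 e3 = - delta *: e1))%type.
Proof.
by split_table; apply: (eq_from_metric g_sym e_basis);
  rewrite (koszul g_sym _ _ _ nabla_LC) !bracket_table ?linE /= ?gramE; field.
Qed.

Local Notation nabla1 := (kobayashi_nomizu_connection nabla J).

(** These are the rules the curvature computation calls for: the bracket puts sums and opposites in
    the left slot, while each [nabla1 ei ej] is zero or a multiple of one basis vector, so zero and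
    scaling suffice on the right. *)
Lemma nabla1_bilinear :
  ((forall Z, nabla1 0 Z = 0) * (forall Z, nabla1 Z 0 = 0) *
   (forall X Z, nabla1 (- X) Z = - nabla1 X Z) *
   (forall X Y Z, nabla1 (X + Y)%R Z = (nabla1 X Z + nabla1 Y Z)%R) *
   (forall a X Z, nabla1 (a *: X) Z = a *: nabla1 X Z) *
   (forall Z a X, nabla1 Z (a *: X) = a *: nabla1 Z X))%type.
Proof.
by split_table=> *; apply: (eq_from_metric g_sym e_basis);
  rewrite /kobayashi_nomizu_connection /canonical_connection /cov_endo
    ?linE /=; ring.
Qed.

(** The table preserves both eigenspaces of J, the plane of e1, e2 and the line of e3. It does not
    contain beta, which enters the curvature only through [e1, e2]. *)
Lemma kobayashi_nomizu_table :
  ((nabla1 e1 e1 = 0) * (nabla1 e1 e2 = 0) * (nabla1 e1 e3 = delta *: e3) *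
   (nabla1 e2 e1 = - alpha *: e2) * (nabla1 e2 e2 = alpha *: e1) *
   (nabla1 e2 e3 = 0) *
   (nabla1 e3 e1 = - gamma *: e2) * (nabla1 e3 e2 = 0) *
   (nabla1 e3 e3 = 0))%type.
Proof.
case: J_e => J1 J2 J3.
by split_table; apply: (eq_from_metric g_sym e_basis);
  rewrite /kobayashi_nomizu_connection /canonical_connection /cov_endo
    ?(J1, J2, J3, levi_civita_table, linE) /= ?gramE; field.
Qed.

Lemma ricci_operator_table (Ric : 'End(V)) :
    is_ricci_operator g (ricci_tensor br g e1 e2 e3 nabla1) Ric ->
  ((Ric e1 = (- (alpha ^+ 2 + beta * gamma))%R *: e1) *
   (Ric e2 = (- alpha ^+ 2)%R *: e2) * (Ric e3 = 0))%type.
Proof.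
(* Read backwards, [RicE] turns each component of Ric into a value of the Ricci tensor on basis
   vectors, a polynomial in the structure constants. *)
move=> RicE; split_table; apply: (eq_from_metric g_sym e_basis);
  rewrite -RicE /ricci_tensor /curvature !bracket_table
    ?(nabla1_bilinear, kobayashi_nomizu_table) ?linE /= ?gramE; ring.
Qed.

End KobayashiNomizu.

Theorem theorem3p17 (R : realType) (V : vectType R)
    (alpha beta gamma delta : R)
    (h_sum : alpha + delta != 0)
    (h_rel : alpha * gamma - beta * delta = 0)
    (br : {bilinear V -> V -> V}) (h_lie : is_lie_bracket br)
    (g : {biscalar V}) (h_sym : is_symmetric_form g)
    (e1 e2 e3 : V) (h_basis : is_pseudo_orthonormal_basis g e1 e2 e3)
    (h12 : br e1 e2 = alpha *: e2 + beta *: e3)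
    (h13 : br e1 e3 = gamma *: e2 + delta *: e3)
    (h23 : br e2 e3 = 0)
    (J : 'End(V)) (h_J : [/\ J e1 = e1, J e2 = e2 & J e3 = - e3])
    (nabla : {bilinear V -> V -> V}) (h_nabla : is_levi_civita br g nabla)
    (Ric1 : 'End(V))
    (h_Ric1 : is_ricci_operator g
       (ricci_tensor br g e1 e2 e3 (kobayashi_nomizu_connection nabla J)) Ric1)
    (c : R) :
  let case_i := [/\ alpha = 0, beta = 0, c = 0 & delta != 0] in
  let case_ii := [/\ alpha != 0, beta = 0 /\ gamma = 0,
                     alpha ^+ 2 + c = 0 & alpha + delta != 0] in
  (first_kind_algebraic_ricci_soliton br Ric1 c <-> case_i \/ case_ii) /\
  (forall D : 'End(V), first_kind_soliton_with br Ric1 c D ->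
     (case_i -> D = 0) /\
     (case_ii -> [/\ D e1 = 0, D e2 = 0 & D e3 = alpha ^+ 2 *: e3])).
Proof.
move=> case_i case_ii.
have [Ric_1 Ric_2 Ric_3] : [/\ Ric1 e1 = (- (alpha ^+ 2 + beta * gamma)) *: e1,
    Ric1 e2 = (- alpha ^+ 2) *: e2 & Ric1 e3 = 0].
  by have RicE :=
    ricci_operator_table h_lie h_sym h_basis h12 h13 h23 h_J h_nabla h_Ric1;
    split; rewrite RicE.
(* The soliton equation forces D = Ric1 - c Id, so D is diagonal in the basis; both implications and
   the formulas for D rest on these eigenvalues. *)
have De (D : 'End(V)) : Ric1 = c *: \1%VF + D ->
    [/\ D e1 = (- (alpha ^+ 2 + beta * gamma + c)) *: e1,
        D e2 = (- (alpha ^+ 2 + c)) *: e2 & D e3 = (- c) *: e3].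
  move=> RicD; have DE X : D X = Ric1 X - c *: X.
    by rewrite RicD add_lfunE scale_lfunE id_lfunE addrAC subrr add0r.
  by split; rewrite DE ?Ric_1 ?Ric_2 ?Ric_3 -?scalerBl ?opprD // sub0r scaleNr.
have gramE := gram h_sym h_basis.
have linE := (endoE Ric1, bilinearE br, bilinearE g).
have metric_ext := eq_from_metric h_sym h_basis.
split; last first.
  move=> D [/De[D1 D2 D3] _]; split.
    case=> a0 b0 c0 _; apply: (eq_endo_on_basis h_basis);
    by rewrite zero_lfunE ?D1 ?D2 ?D3 ?a0 ?b0 c0 ?expr0n ?mul0r ?addr0 oppr0 scale0r.
  case=> _ [b0 _] ac0 _.
  rewrite D1 D2 D3 b0 mul0r addr0 ac0 oppr0 !scale0r; split=> //.
  by congr (_ *: _); lra.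
split.
  case=> D [/De[D1 D2 D3] derD].
  have linDE := (endoE D, bilinearE br, bilinearE g).
  have := derD e1 e3; have := derD e1 e2.
  rewrite h12 h13 ?linDE D1 D2 D3 ?linDE h12 h13.
  move=> D12 D13.
  have /= := congr1 (g^~ e3) D13; have /= := congr1 (g^~ e2) D13.
  have /= := congr1 (g^~ e3) D12; have /= := congr1 (g^~ e2) D12.
  rewrite ?linDE /= !gramE => E1 E2 E3 E4.
  (* With K the left-hand side, [E1] to [E4] amount to alpha K = 0, beta (K + alpha^2) = 0, gamma
     (alpha^2 - K) = 0 and delta K = 0; adding the first and last gives (alpha + delta) K = 0. *)
  have K0 : alpha ^+ 2 + beta * gamma + c = 0.
    by apply: (mulfI h_sum); lra.
  have [a0|a_neq0] := eqVneq alpha 0.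
    have d_neq0 : delta != 0 by move: h_sum; rewrite a0 add0r.
    have b0 : beta = 0 by apply: (mulIf d_neq0); move: h_rel; rewrite a0; lra.
    by left; split=> //; move: K0; rewrite a0 b0; lra.
  have a2_neq0 : alpha ^+ 2 != 0 by rewrite expf_neq0.
  have b0 : beta = 0 by apply: (mulIf a2_neq0); nra.
  have g0 : gamma = 0 by apply: (mulIf a2_neq0); nra.
  by right; split=> //; move: K0; rewrite b0; lra.
move=> cases; set D := Ric1 - c *: \1%VF; exists D.
have RicD : Ric1 = c *: \1%VF + D by rewrite addrC subrK.
have [D1 D2 D3] := De D RicD; split=> //.
have linDE := (endoE D, bilinearE br, bilinearE g).
(* Each case is recast as values to substitute, with c solved for in case (ii), so that [ring]
   closes every component of the derivation identity. *)
have : [/\ alpha = 0, beta = 0 & c = 0] \/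
       [/\ beta = 0, gamma = 0 & c = - alpha ^+ 2].
  case: cases => [[]|[_ [? ?] /eqP]]; first by left.
  by rewrite addrC addr_eq0 => /eqP ?; right.
by case=> -[E1 E2 E3];
  apply: (lie_derivation_on_basis h_basis h_lie); apply: metric_ext;
  rewrite ?(h12, h13, h23) ?linDE ?D1 ?D2 ?D3 ?linDE ?(h12, h13, h23) ?linDE
    /= ?gramE ?E1 ?E2 ?E3; ring.
Qed.
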